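(* Let $\mathcal{P}$ be a countable set, $X$ a Polish space, and $A\subseteq C_p(X,\mathbb{R}^{\mathcal{P}})$ such that for every $P\in\mathcal{P}$ the set $\pi_P\circ A=\{\pi_P\circ f:f\in A\}\subseteq C_p(X)$ is pointwise bounded. Then for every compact $K\subseteq X$ the following are equivalent: (i) $A|_K$ is relatively compact in $B_1(K,\mathbb{R}^{\mathcal{P}})$; (ii) $\pi_P\circ A|_K$ has (finitary) NIP for every $P\in\mathcal{P}$.
   Context: $\mathbb{R}^{\mathcal{P}}$ has the product topology and $\pi_P:\mathbb{R}^{\mathcal{P}}\to\mathbb{R}$ is the $P$-th coordinate projection. $C_p(X,Y)$ is the space of continuous maps $X\to Y$ with the pointwise convergence topology; $B_1(K,\mathbb{R}^{\mathcal{P}})$ is the space of maps $K\to\mathbb{R}^{\mathcal{P}}$ that are pointwise limits of sequences of continuous maps, with the pointwise convergence topology; relatively compact means the closure in that space is compact. $A|_K=\{f|_K:f\in A\}$. A set of functions is pointwise bounded if its values at each point form a bounded set. A set $B$ of real functions on a set $Y$ has (finitary) NIP if for every sequence $(f_n)_{n\in\mathbb{N}}\subseteq B$ and reals $a<b$ there are finite disjoint $E,F\subseteq\mathbb{N}$ with $\{y\in Y: f_i(y)\le a\ \forall i\in E,\ f_j(y)\ge b\ \forall j\in F\}=\emptyset$. *)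

(* Defs.v *)
From mathcomp Require Import all_boot all_order all_algebra.
From mathcomp Require Import all_classical all_reals all_analysis.
Set Implicit Arguments.
Unset Strict Implicit.
Unset Printing Implicit Defensive.
Import Order.TTheory GRing.Theory Num.Theory.
Import numFieldNormedType.Exports.
Local Open Scope classical_set_scope.
Local Open Scope ring_scope.

Definition separable (T : topologicalType) :=
  exists2 D : set T, countable D & dense D.

Definition is_metric (R : realType) (T : Type) (d : T -> T -> R) :=
  [/\ forall x y, 0 <= d x y,
      forall x y, d x y = 0 <-> x = y,
      forall x y, d x y = d y x &
      forall x y z, d x z <= d x y + d y z].

Definition metric_compatible (R : realType) (T : topologicalType)
    (d : T -> T -> R) :=
  forall (x : T) (U : set T),
    nbhs x U <-> exists2 e : R, 0 < e & [set y | d x y < e] `<=` U.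

Definition metric_complete (R : realType) (T : topologicalType)
    (d : T -> T -> R) :=
  forall u : nat -> T,
    (forall e : R, 0 < e ->
       exists N, forall m n, (N <= m)%N -> (N <= n)%N -> d (u m) (u n) < e) ->
    exists l : T, u @ \oo --> l.

Definition completely_metrizable (R : realType) (T : topologicalType) :=
  exists d : T -> T -> R,
    [/\ is_metric d, metric_compatible d & metric_complete d].

(* The empty space counts as Polish. *)
Definition polish (R : realType) (T : topologicalType) :=
  separable T /\ completely_metrizable R T.

Definition pointwise_bounded_set (R : realType) (Y : Type)
    (B : set (Y -> R)) :=
  forall y, bounded_set [set f y | f in B].

(* Seen as a type, i.e. through the coercion [set_type], [baire1 X Y] carries
   the topology induced by {ptws X -> Y}. *)
Definition baire1 (X Y : topologicalType) : set {ptws X -> Y} :=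
  [set f | exists2 u : nat -> X -> Y,
     (forall n, continuous (u n)) & (forall x, u n x @[n --> \oo] --> f x)].
Arguments baire1 : clear implicits.

(* The closure is taken in the subspace S, not in T. *)
Definition relatively_compact_in (T : topologicalType) (S B : set T) :=
  B `<=` S /\ compact (closure (set_val @^-1` B : set S)).

Definition finitary_NIP (R : realType) (Y : Type) (B : set (Y -> R)) :=
  forall f : nat -> Y -> R, (forall n, B (f n)) ->
  forall a b : R, a < b ->
  exists E F : set nat,
    [/\ finite_set E, finite_set F, E `&` F = set0 &
        [set y | (forall i, E i -> f i y <= a) /\
                 (forall j, F j -> b <= f j y)] = set0].

(* Main.v *)
(* NIP gives compactness by Tychonoff once every pointwise limit [f] of the
   functions is Baire 1 on [K]. NIP forbids a nonempty set on which [f < a] and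
   [f > b] are both dense, so a Cantor-Bendixson argument covers [K] by countably
   many closed sets on each of which [f >= a] or [f <= b]. Intersecting such covers
   over a grid of levels gives countable closed covers on which [f] oscillates
   little. Conversely, an independent sequence has branches on which a cluster point
   is forced below [a] or above [b], and a Baire category argument along the tree of
   finite branches prevents that cluster point from being Baire 1. *)

Require Import Defs.
From mathcomp Require Import all_boot all_order all_algebra.
From mathcomp Require Import all_classical all_reals all_analysis.
From mathcomp Require Import lra.
Import Order.TTheory GRing.Theory Num.Theory.
Import numFieldNormedType.Exports.
Local Open Scope classical_set_scope.
Local Open Scope ring_scope.

(** * Baire 1 functions from closed covers of a metric space *)

Section baire1_criterion.
Context {R : realType} {T : topologicalType} {d : T -> T -> R}.
Hypotheses (d_metric : is_metric d) (d_compat : metric_compatible d).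

(* The distance to [C] truncated at [1], so that [inf] is never taken over the
   empty set. *)
Let dist (C : set T) (x : T) : R := inf (1 |` [set d x y | y in C]).

Let dist_has_inf C x : has_inf (1 |` [set d x y | y in C]).
Proof.
split; first by exists 1; left.
exists 0 => _ [->//|[y Cy <-]]; by case: d_metric.
Qed.

Let dist_triangle C x y : dist C x <= d x y + dist C y.
Proof.
have [d0 _ _ dtri] := d_metric.
rewrite -lerBlDl; apply: lb_le_inf; first by exists 1; left.
move=> _ [->|[z Cz <-]]; rewrite lerBlDl.
  by apply: (@le_trans _ _ 1); [apply: ge_inf; [case: (dist_has_inf C x)|left]
    | rewrite lerDr].
apply: (le_trans _ (dtri x y z)); apply: ge_inf; first by case: (dist_has_inf C x).
by right; exists z.
Qed.

Let dist_continuous C : continuous (dist C).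
Proof.
have [_ _ dC _] := d_metric.
move=> x; apply/cvgrPdist_lt => e e0; apply/(d_compat x); exists e => // y /= dxy.
have := dist_triangle C x y; have := dist_triangle C y x.
rewrite (dC y x) => h1 h2; rewrite ltr_norml; apply/andP; split; lra.
Qed.

(** The functions [max 0 (1 - n * dist C)] work because [dist C] vanishes on [C] and is positive off
    a closed [C]. Being eventually equal to 0, rather than only tending to 0, lets finitely many of
    these weights be discarded exactly in [closed_cover_approx]. *)
Lemma closed_indicator_approx (C : set T) : closed C ->
  exists z : nat -> T -> R, [/\ forall n, continuous (z n),
    forall n x, C x -> z n x = 1 &
    forall x, ~ C x -> \forall n \near \oo, z n x = 0].
Proof.
have [d0 deq dC dtri] := d_metric => Ccl.
exists (fun n x => Num.max 0 (1 - n%:R * dist C x)); split.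
- move=> n x; apply: (@continuous_max R T (cst 0) (fun x => 1 - n%:R * dist C x)).
    exact: cvg_cst.
  apply: cvgB; first exact: cvg_cst.
  by apply: cvgM; [exact: cvg_cst|exact: dist_continuous].
- move=> n x Cx; have -> : dist C x = 0.
    apply/le_anti/andP; split.
      apply: ge_inf; first by case: (dist_has_inf C x).
      by right; exists x => //; apply/deq.
    apply: lb_le_inf; first by exists 1; left.
    by move=> _ [->//|[y _ <-]].
  by rewrite mulr0 subr0; apply/max_idPr.
- move=> x nCx.
  have /(d_compat x)[e e0 eC] : nbhs x (~` C).
    by apply: open_nbhs_nbhs; split => //; exact: closed_openC.
  have dx0 : 0 < dist C x.
    apply: (@lt_le_trans _ _ (Num.min e 1)); first by rewrite lt_min e0 ltr01.
    apply: lb_le_inf; first by exists 1; left.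
    move=> _ [->|[y Cy <-]]; rewrite ge_min ?lexx ?orbT //.
    apply/orP; left; rewrite leNgt; apply/negP => /eC; exact.
  near=> n; apply/max_idPl; rewrite subr_le0 -ler_pdivrMr// div1r.
  near: n; exact: nbhs_infty_ger.
Unshelve. all: by end_near. Qed.

(** Here [g x] is the value attached to the first closed set containing [x]. That set has weight 1
    at [x], and the finitely many earlier ones eventually have weight 0, so the approximants reach
    [g x] exactly. *)
Lemma closed_cover_approx (C : nat -> set T) (c : nat -> R) :
  (forall k, closed (C k)) -> (forall x, exists k, C k x) ->
  exists (u : nat -> T -> R) (g : T -> R), [/\ forall n, continuous (u n),
    forall x, \forall n \near \oo, u n x = g x &
    forall x, exists2 k, C k x & g x = c k].
Proof.
move=> Ccl Ccov.
have /choice[z zP] k := closed_indicator_approx (C k) (Ccl k).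
(* [h n m k] interpolates the value [c j] of the first [j] in [k, k + m)
   with [C j x]. *)
pose h n := fix h m k x := if m is m'.+1
  then z k n x * c k + (1 - z k n x) * h m' k.+1 x else 0.
have hC n m k : continuous (h n m k).
  elim: m k => [|m IH] k x /=; first exact: cvg_cst.
  have zc : z k n y @[y --> x] --> z k n x by case: (zP k) => + _ _; exact.
  apply: cvgD; first by apply: cvgM; [exact: zc|exact: cvg_cst].
  apply: cvgM; last exact: IH.
  by apply: cvgB; [exact: cvg_cst|exact: zc].
have first_hit x : exists k, C k x /\ forall j, (j < k)%N -> ~ C j x.
  have ex : exists k, `[< C k x >] by have [k] := Ccov x; exists k; apply/asboolP.
  case: (ex_minnP ex) => k /asboolP Ck kmin; exists k; split => // j jk.
  by move=> /asboolP /kmin; rewrite leqNgt jk.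
have [k0 k0P] := choice first_hit.
exists (fun n => h n n 0%N), (c \o k0); split => //.
- move=> x; have [Ck Cj] := k0P x.
  (* The fuel [m] must carry the recursion from [k] past [k0 x]: earlier weights vanish, and the
     weight 1 at [k0 x] cancels the tail. *)
  have hE n : (forall j, (j < k0 x)%N -> z j n x = 0) ->
      forall m k, (k <= k0 x)%N -> (k0 x < k + m)%N -> h n m k x = c (k0 x).
    move=> zj0; elim=> [|m IH] k kk0 k0m /=.
      by move: k0m; rewrite addn0 ltnNge kk0.
    have [keq|kneq] := eqVneq k (k0 x).
      have -> : z k n x = 1 by rewrite keq; case: (zP (k0 x)) => _ + _; exact.
      by rewrite subrr mul0r addr0 mul1r keq.
    have klt : (k < k0 x)%N by rewrite ltn_neqAle kneq.
    by rewrite zj0// mul0r add0r subr0 mul1r IH// addSnnS.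
  have : \forall n \near \oo, forall j, (j < k0 x)%N -> z j n x = 0.
    have : forall k, (k <= k0 x)%N -> \forall n \near \oo,
        forall j, (j < k)%N -> z j n x = 0.
      elim=> [|k IH] kk0; first by near=> n.
      have := IH (ltnW kk0); case: (zP k) => _ _ /(_ x (Cj _ kk0)) zk zlt.
      apply: filterS2 zk zlt => n zk zlt j; rewrite ltnS leq_eqVlt.
      by move=> /orP[/eqP->|]//; exact: zlt.
    by move=> /(_ _ (leqnn _)).
  move=> zn; near=> n; rewrite /= hE//.
    by near: n.
  by rewrite add0n; near: n; exact: nbhs_infty_gt.
- by move=> x; exists (k0 x) => //; case: (k0P x).
Unshelve. all: by end_near. Qed.

End baire1_criterion.

(* Clipping the approximants of one level to a narrow band around those of the
   previous level makes the diagonal sequence converge. *)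
Lemma baire1_uniform_limit {R : realType} {T : topologicalType} (f : T -> R) :
  (forall e : R, 0 < e -> exists (u : nat -> T -> R) (g : T -> R),
    [/\ forall n, continuous (u n),
      forall x, \forall n \near \oo, u n x = g x &
      forall x, `|f x - g x| <= e]) ->
  exists2 u : nat -> T -> R, (forall n, continuous (u n)) &
    (forall x, u n x @[n --> \oo] --> f x).
Proof.
move=> fapprox.
pose e (i : nat) : R := 2^-1 ^+ i.
have e0 i : 0 < e i by rewrite exprn_gt0.
have eS i : e i = e i.+1 + e i.+1 by rewrite /e exprS; lra.
have /choice[u /choice[g ug]] i := fapprox (e i) (e0 i).
(* The radius [2 * e i] exceeds [e i + e i.+1], which bounds the distance from [g i] to [g i.+1]. At
   each point the clipping is therefore inactive for large [n], and [v n i.+1] still ends at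
   [g i.+1]. *)
pose v n := fix v i x := if i is i'.+1
  then Num.max (v i' x - 2 * e i') (Num.min (u i n x) (v i' x + 2 * e i'))
  else u 0%N n x.
have vC n i : continuous (v n i).
  elim: i => [|i IH] x; first by case: (ug 0%N) => + _ _; exact.
  have uc : {for x, continuous (u i.+1 n)} by case: (ug i.+1) => + _ _; exact.
  apply: (@continuous_max R T (fun x => v n i x - 2 * e i)
    (fun x => Num.min (u i.+1 n x) (v n i x + 2 * e i))).
    by apply: cvgB; [exact: IH|exact: cvg_cst].
  apply: (@continuous_min R T (u i.+1 n) (fun x => v n i x + 2 * e i)) => //.
  by apply: cvgD; [exact: IH|exact: cvg_cst].
have v_step n i x : `|v n i.+1 x - v n i x| <= 2 * e i.
  rewrite /=; set w := v n i x; have := e0 i; move: (u _ _ _) => t ei.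
  rewrite ler_norml /Num.min; case: ltP => ?; rewrite /Num.max; case: ltP => ?;
  by apply/andP; split; lra.
(* The bound is the geometric sum of the steps [2 * e k] for [k] from [i] to [i + m - 1]. It is
   uniform in [n], hence usable on the diagonal. *)
have v_band n i m x : `|v n (i + m)%N x - v n i x| <= 4 * e i - 4 * e (i + m)%N.
  elim: m => [|m IH]; first by rewrite addn0 !subrr normr0.
  rewrite addnS; have := v_step n (i + m)%N x; have := eS (i + m)%N.
  move: IH; rewrite !ler_norml => /andP[? ?] ? /andP[? ?]; apply/andP; split; lra.
have v_lim i x : \forall n \near \oo, v n i x = g i x.
  elim: i => [|i IH]; first by case: (ug 0%N) => _ + _; exact.
  case: (ug i.+1) => _ /(_ x) ui /(_ x) fi; case: (ug i) => _ _ /(_ x) fi'.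
  apply: filterS2 ui IH => n /= -> ->.
  have := e0 i; have := e0 i.+1; have := eS i.
  move: fi fi'; rewrite !ler_norml => /andP[? ?] /andP[? ?] ? ? ?.
  by rewrite /Num.min; case: ltP => ?; rewrite /Num.max; case: ltP => ?; lra.
exists (fun n => v n n) => // x; apply/cvgrPdist_lt => eps eps0.
(* Four units pay for the band from level [i] to the diagonal, one for the distance from [g i] to
   [f]. *)
have [i ie] : exists i, 5 * e i < eps.
  have : e i @[i --> \oo] --> 0 by apply: cvg_expr; rewrite ger0_norm; lra.
  move=> /cvgrPdist_lt /(_ (eps / 5)).
  case; first by lra.
  move=> N _ /(_ N (leqnn _)) /=; rewrite sub0r normrN gtr0_norm// => ?.
  by exists N; lra.
near=> n.
have <- : (i + (n - i))%N = n by rewrite subnKC//; near: n; exact: nbhs_infty_ge.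
have := v_band n i (n - i)%N x; have := e0 (i + (n - i))%N.
rewrite (_ : v n i x = g i x); last by near: n.
case: (ug i) => _ _ /(_ x).
rewrite !ler_norml ltr_norml => /andP[? ?] ? /andP[? ?].
have -> : v (i + (n - i))%N (i + (n - i))%N x = v n (i + (n - i))%N x.
  by rewrite {1}subnKC//; near: n; exact: nbhs_infty_ge.
by apply/andP; split; lra.
Unshelve. all: by end_near. Qed.

(** * From NIP to countable closed covers *)

(* Membership of [f] in the closure of [B] for pointwise convergence. *)
Definition eval_closure {R : realType} {T : topologicalType} (B : set (T -> R))
    (f : T -> R) :=
  forall (s : seq T) (U : T -> set R), (forall x, x \in s -> nbhs (f x) (U x)) ->
    exists2 g, B g & forall x, x \in s -> U x (g x).

Lemma finite_nat_bounded (E : set nat) : finite_set E ->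
  exists n, forall i, E i -> (i < n)%N.
Proof.
move=> /finite_seqP[s ->]; exists (\max_(i <- s) i).+1 => i /= si.
by rewrite ltnS; apply: (leq_bigmax_seq (F := id)).
Qed.

(* Otherwise a tree of open sets meeting [D] yields a sequence in [B] all of
   whose finite sign patterns are realised. *)
Lemma NIP_not_bidense {R : realType} {T : topologicalType}
    (B : set (T -> R)) (f : T -> R) (a b : R) (D : set T) :
  a < b -> B `<=` [set g | continuous g] -> finitary_NIP B ->
  eval_closure B f -> D !=set0 ->
  exists U : set T, [/\ open U, U `&` D !=set0 &
    (forall x, U x -> D x -> a <= f x) \/ (forall x, U x -> D x -> f x <= b)].
Proof.
move=> ab Bc NIP fB D0; apply: contrapT => nU.
have below U : open U -> U `&` D !=set0 -> exists x, [/\ U x, D x & f x < a].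
  move=> Uo UD; apply: contrapT => nx; apply: nU; exists U; split => //; left.
  by move=> x Ux Dx; rewrite leNgt; apply/negP => fxa; apply: nx; exists x.
have above U : open U -> U `&` D !=set0 -> exists x, [/\ U x, D x & b < f x].
  move=> Uo UD; apply: contrapT => nx; apply: nU; exists U; split => //; right.
  by move=> x Ux Dx; rewrite leNgt; apply/negP => fxa; apply: nx; exists x.
pose cell := fix cell (gs : seq (T -> R)) (s : seq bool) : set T :=
  match gs, s with
  | g :: gs', e :: s' =>
      [set x | if e then g x < a else b < g x] `&` cell gs' s'
  | _, _ => setT
  end.
pose good gs := (forall s, open (cell gs s)) /\
  forall s, size s = size gs -> cell gs s `&` D !=set0.
have half_open g e : B g -> open [set x | if e then g x < a else b < g x].
  move=> /Bc /continuousP go.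
  by case: e; [exact: (go [set r | r < a])|exact: (go [set r | b < r])].
have step gs : exists g, good gs -> B g /\ good (g :: gs).
  have [[gso gsD]|ng] := pselect (good gs); last by exists (cst 0).
  (* Each of the finitely many cells contains a point of [D] with [f < a] and one with [b < f]. A
     single [g] in [B] close to [f] at all these points splits every cell at once. *)
  have xP (t : (size gs).-tuple bool) := below _ (gso t) (gsD _ (size_tuple t)).
  have yP (t : (size gs).-tuple bool) := above _ (gso t) (gsD _ (size_tuple t)).
  have [x {}xP] := choice xP; have [y {}yP] := choice yP.
  have [|g Bg gP] := fB (codom x ++ codom y)
      (fun z => [set r | (f z < a -> r < a) /\ (b < f z -> b < r)]).
    move=> z _; apply: filterI.
      have [fa|fa] := boolP (f z < a); last by near=> r.
      by have := open_nbhs_nbhs (conj (open_lt (y:=a)) fa); apply: filterS.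
    have [fa|fa] := boolP (b < f z); last by near=> r.
    by have := open_nbhs_nbhs (conj (open_gt (y:=b)) fa); apply: filterS.
  exists g => _; split => //; split.
    by case=> [|e s] /=; [exact: openT|apply: openI; [exact: half_open|]].
  case=> // e s [] /eqP szs; pose t := Tuple szs.
  have [xt xD fx] := xP t; have [yt yD fy] := yP t.
  case: e; [exists (x t)|exists (y t)]; split => //; split => //=.
  - by case: (gP (x t)) => [|+ _]; [rewrite mem_cat codom_f|exact].
  - by case: (gP (y t)) => [|_ +]; [rewrite mem_cat codom_f orbT|exact].
have [next nextP] := choice step.
pose hist n := iter n (fun gs => next gs :: gs) [::].
have hist_good n : good (hist n).
  elim: n => [|n IH]; last by case: (nextP _ IH).
  split; first by case=> *; exact: openT.
  by case=> // _; case: D0 => x Dx; exists x.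
have nextB n : B (next (hist n)) by case: (nextP _ (hist_good n)).
have [E [F [finE finF EF0 EF]]] := NIP (fun n => next (hist n)) nextB a b ab.
have [n1 En] := finite_nat_bounded _ finE; have [n2 Fn] := finite_nat_bounded _ finF.
(* The pattern asks for values below [a] on [E] and above [b] at all other indices, in particular on
   [F] by disjointness. It lists the latest index first, as [hist] does. *)
pose s := fix s n := if n is n'.+1 then `[< E n' >] :: s n' else [::].
have szs : size (s (n1 + n2)%N) = size (hist (n1 + n2)%N).
  by elim: (n1 + n2)%N => //= n ->.
have [x [xc _]] := (hist_good (n1 + n2)%N).2 _ szs.
have {}xc : forall i, (i < n1 + n2)%N ->
    if `[< E i >] then next (hist i) x < a else b < next (hist i) x.
  elim: (n1 + n2)%N xc => // n IH [xn /IH{}IH] i.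
  by rewrite ltnS leq_eqVlt => /orP[/eqP->|/IH].
suff : set0 x by [].
rewrite -EF; split=> [i Ei|j Fj].
  have := xc i (ltn_addr _ (En _ Ei)).
  by case: asboolP => // _ /ltW.
have := xc j (ltn_addl _ (Fn _ Fj)).
case: asboolP => [Ej|_ /ltW //].
by have : (E `&` F) j by []; rewrite EF0.
Unshelve. all: by end_near. Qed.

(** Closures are required to fit into the neighbourhood because the exhaustion argument below needs
    a closed piece inside a given open set. *)
Definition regular_base {T : topologicalType} (e : nat -> set T) :=
  (forall n, open (e n)) /\
  forall x U, nbhs x U -> exists n, e n x /\ closure (e n) `<=` U.

(** Let [W] be the union of the base sets that admit such a countable cover. If its closed
    complement were nonempty, some base set [e m] around one of its points would have
    [closure (e m) \ W] on one side. Adding this single closed set to the cover of [W] covers [e m],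
    which forces [e m] into [W]. This replaces a transfinite derivation by one step. *)
Lemma closed_cover_of_halves {R : realType} {T : topologicalType}
    (e : nat -> set T) (f : T -> R) (a b : R) :
  regular_base e ->
  (forall D : set T, D !=set0 -> exists U : set T, [/\ open U, U `&` D !=set0 &
    (forall x, U x -> D x -> a <= f x) \/ (forall x, U x -> D x -> f x <= b)]) ->
  exists C : nat -> set T, [/\ forall k, closed (C k),
    forall x, exists k, C k x &
    forall k, C k `<=` [set x | a <= f x] \/ C k `<=` [set x | f x <= b]].
Proof.
move=> [eo ebase] halves.
pose halving (C : nat -> set T) := forall k, closed (C k) /\
  (C k `<=` [set x | a <= f x] \/ C k `<=` [set x | f x <= b]).
pose good n := exists2 C, halving C & e n `<=` \bigcup_k C k.
(* Indices that are not good receive empty sets, so the joint enumeration [CW] consists of one-sided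
   closed sets throughout. *)
have /choice[C CP] n : exists C, halving C /\ (good n -> e n `<=` \bigcup_k C k).
  have [[C hC eC]|ng] := pselect (good n); first by exists C.
  by exists (fun=> set0); split=> // k; split; [exact: closed0|left].
pose W := \bigcup_(n in good) e n.
pose CW m := if unpickle m is Some nk then C nk.1 nk.2 else set0.
have CWh : halving CW.
  move=> m; rewrite /CW; case: unpickle => [nk|]; first by case: (CP nk.1) => + _; exact.
  by split; [exact: closed0|left].
have WCW : W `<=` \bigcup_k CW k.
  move=> x [n gn enx]; have [k _ Ckx] := (CP n).2 gn x enx.
  by exists (pickle (n, k)) => //; rewrite /CW pickleK.
have WT x : W x.
  apply: contrapT => nWx.
  have [|U [Uo [y [Uy nWy]] UW]] := halves (~` W); first by exists x.
  have [m [emy emU]] := ebase y U (open_nbhs_nbhs (conj Uo Uy)).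
  apply: nWy; exists m => //.
  exists (fun k => if k is k'.+1 then CW k' else closure (e m) `&` ~` W).
    case=> [|k]; last exact: CWh; split.
      apply: closedI; first exact: closed_closure.
      by apply: open_closedC; apply: bigcup_open => n _; exact: eo.
    by case: UW => UW; [left|right] => z [/emU Uz nWz] /=; exact: UW.
  move=> z emz; have [/WCW[k _ kz]|nWz] := pselect (W z); first by exists k.+1.
  by exists 0%N => //; split => //; exact: subset_closure.
exists CW; split=> [k|x|k]; [by case: (CWh k)| |by case: (CWh k)].
by have [k _ ?] := WCW x (WT x); exists k.
Qed.

(** On a grid of mesh [e = eps / 2], take [j] with [p j <= f x < p j + e]. The piece of [L j] at [x]
    cannot lie in [f <= p j - e], nor that of [H j] in [f >= p j + e], so both carry the opposite
    bound and their intersection stays within [2 * e] of [p j]. The condition [Q] retains just such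
    pairs of pieces. *)
Lemma closed_cover_small_oscillation {R : realType} {T : topologicalType}
    (f : T -> R) :
  (forall a b : R, a < b -> exists C : nat -> set T, [/\ forall k, closed (C k),
    forall x, exists k, C k x &
    forall k, C k `<=` [set x | a <= f x] \/ C k `<=` [set x | f x <= b]]) ->
  forall eps : R, 0 < eps -> exists (C : nat -> set T) (c : nat -> R),
    [/\ forall k, closed (C k), forall x, exists k, C k x &
      forall k x, C k x -> `|f x - c k| <= eps].
Proof.
move=> halves eps eps0.
have [e e0 epsE] : exists2 e, 0 < e & eps = 2 * e by exists (eps / 2); lra.
pose p (j : int) : R := j%:~R * e.
have lo j : p j - 2 * e < p j - e by lra.
have hi j : p j + e < p j + 2 * e by lra.
have /choice[L LP] j := halves _ _ (lo j).
have /choice[H HP] j := halves _ _ (hi j).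
pose Q (t : int * nat * nat) := L t.1.1 t.1.2 `<=` [set x | p t.1.1 - 2 * e <= f x] /\
  H t.1.1 t.2 `<=` [set x | f x <= p t.1.1 + 2 * e].
pose C n := if unpickle n is Some t then
  [set x | Q t /\ (L t.1.1 t.1.2 `&` H t.1.1 t.2) x] else set0.
pose c n := if @unpickle (int * nat * nat)%type n is Some t then p t.1.1 else 0.
exists C, c; split.
- move=> n; rewrite /C; case: unpickle => [t|]; last exact: closed0.
  have [Qt|nQt] := pselect (Q t); last first.
    by rewrite (_ : [set _ | _] = set0); [exact: closed0|rewrite -subset0 => x []].
  rewrite (_ : [set _ | _] = L t.1.1 t.1.2 `&` H t.1.1 t.2).
    by apply: closedI; [case: (LP t.1.1)|case: (HP t.1.1)] => + _ _; exact.
  by apply/seteqP; split=> x => [[]|].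
- move=> x; pose j := Num.floor (f x / e).
  have : j%:~R <= f x / e < (j + 1)%:~R by rewrite floor_itv.
  rewrite ler_pdivlMr// ltr_pdivrMr// intrD mulrDl mul1r -/(p j) => /andP[jl jr].
  have [_ /(_ x)[k Lk] /(_ k)Lh] := LP j; have [_ /(_ x)[l Hl] /(_ l)Hh] := HP j.
  exists (pickle (j, k, l)); rewrite /C pickleK; split => //; split => /=.
    by case: Lh => // /(_ _ Lk) /=; lra.
  by case: Hh => // /(_ _ Hl) /=; lra.
- move=> n x; rewrite /C /c; case: unpickle => // t [[Lt Ht] [/Lt /= ? /Ht /= ?]].
  by rewrite epsE ler_norml; apply/andP; split; lra.
Qed.

Lemma NIP_closure_baire1 {R : realType} {T : topologicalType} (d : T -> T -> R)
    (e : nat -> set T) (B : set (T -> R)) (f : T -> R) :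
  is_metric d -> metric_compatible d -> regular_base e ->
  B `<=` [set g | continuous g] -> finitary_NIP B -> eval_closure B f ->
  exists2 u : nat -> T -> R, (forall n, continuous (u n)) &
    (forall x, u n x @[n --> \oo] --> f x).
Proof.
move=> dm dc eb Bc NIP fB; apply: baire1_uniform_limit => eps eps0.
have [|C [c [Ccl Ccov Cc]]] := closed_cover_small_oscillation f _ _ eps0.
  move=> a b ab; apply: (closed_cover_of_halves _ _ _ _ eb) => D D0.
  exact: NIP_not_bidense ab Bc NIP fB D0.
have [u [g [uc ug gC]]] := closed_cover_approx dm dc C c Ccl Ccov.
exists u, g; split => // x; have [k Ckx ->] := gC x; exact: Cc.
Qed.

(** * Compactness and bases in products and subspaces *)

Lemma cvg_ptws {I : Type} {V : topologicalType} (F : set_system {ptws I -> V})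
    (f : {ptws I -> V}) :
  Filter F -> (forall i, g i @[g --> F] --> f i) -> F --> f.
Proof.
move=> FF Ff; apply/cvg_sup => i A [_ [[W oW <-] Wf WA]].
rewrite nbhs_filterE; apply: (filterS WA).
by apply: (Ff i W); apply: open_nbhs_nbhs.
Qed.

Lemma compact_set_val {T : topologicalType} (S : set T) (A : set S) :
  compact (set_val @` A) -> compact A.
Proof.
move=> cA F FF FA.
have val_image G : F G -> (set_val @ F) (set_val @` G).
  move=> FG; apply: (@filterS _ F _ G) => // s Gs; by exists s.
have [_ [[s As <-] Fs]] := cA _ _ (val_image A FA).
exists s; split => // P Q FP [_ [[W oW <-] Ws WQ]].
have [_ [[y Py <-] Wy]] := Fs _ _ (val_image P FP) (open_nbhs_nbhs (conj oW Ws)).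
by exists y; split => //; exact: WQ.
Qed.

Lemma compact_subtypeT {T : topologicalType} (K : set T) :
  compact K -> compact [set: K].
Proof.
move=> cK; apply: compact_set_val; rewrite (_ : _ @` _ = K)//.
apply/seteqP; split=> [_ [x _ <-]|x Kx]; first exact: set_valP.
by exists (exist _ x (mem_set Kx)).
Qed.

(** Once the closure in [T] lies in [S], it is the image under [set_val] of the closure taken in
    [S], and compactness descends along [set_val]. *)
Lemma relatively_compact_inP {T : topologicalType} (S B : set T) :
  compact (closure B) -> closure B `<=` S -> B `<=` S -> relatively_compact_in S B.
Proof.
move=> cB clBS BS; split => //; apply: compact_set_val.
rewrite (_ : _ @` _ = closure B)//; apply/seteqP; split=> [_ [s sB <-] U Us|x clx].
  have [|y [By Uy]] := sB (set_val @^-1` U).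
    exact: initial_continuous.
  by exists (set_val y).
exists (exist _ x (mem_set (clBS _ clx))) => // U [_ [[W oW <-] Wx WU]].
have [y [By Wy]] := clx W (open_nbhs_nbhs (conj oW Wx)).
exists (exist _ y (mem_set (BS _ By))); split => //; exact: WU.
Qed.

Lemma separable_metric_regular_base {R : realType} {T : topologicalType}
    (d : T -> T -> R) :
  is_metric d -> metric_compatible d -> separable T ->
  exists e : nat -> set T, regular_base e.
Proof.
move=> [d0 deq dC dtri] dc [D /countable_injP[phi phi_inj] Dd].
have ball_open c (r : R) : open [set y | d c y < r].
  rewrite openE => y /= cy; apply/(dc y).
  exists (r - d c y); first by rewrite subr_gt0.
  by move=> z /= yz; have := dtri c y z; lra.
(* Since [phi] is injective on [D], each union contains at most one ball; codes of no centre give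
   the empty set. *)
pose e n : set T := if unpickle n is Some mq then
  \bigcup_(c in [set c | D c /\ phi c = mq.2]) [set y | d c y < mq.1.+1%:R^-1]
  else set0.
exists e; split=> [n|x U].
  by rewrite /e; case: unpickle => [mq|]; [apply: bigcup_open => c _|exact: open0].
move=> /(dc x)[r r0 rU].
have [m mr] : exists m : nat, m.+1%:R^-1 < r / 2.
  have r20 : 0 < r / 2 by lra.
  have [N _ /(_ N (leqnn _)) /= Nr] := near_infty_natSinv_lt (PosNum r20).
  by exists N.
have m0 : 0 < m.+1%:R^-1 :> R by rewrite invr_gt0.
have [q qE] : exists q : R, m.+1%:R^-1 = q by exists m.+1%:R^-1.
rewrite qE in mr m0.
have [|c [/= xc Dc]] := Dd [set y | d x y < q] _ (ball_open _ _).
  by exists x => /=; rewrite (_ : d x x = 0)//; apply/deq.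
exists (pickle (m, phi c)); rewrite /e pickleK /= qE; split=> /=.
  by exists c => //=; rewrite dC.
move=> y cly; apply: rU => /=.
(* The path from [x] to [y] through [c] and [z] spends less than [q] on each of its first two legs,
   leaving [r - 2 * q] for the last. *)
have yball : nbhs y [set z | d y z < r - 2 * q].
  by apply/(dc y); exists (r - 2 * q) => //; lra.
have [z [[c' /= [Dc' cc'] c'z] /= yz]] := cly _ yball.
have cz : d c z < q by rewrite -(phi_inj c' c)// ?inE.
have := dtri x c y; have := dtri c z y; rewrite (dC z y); lra.
Qed.

Lemma regular_base_subtype {T : topologicalType} (K : set T) (e : nat -> set T) :
  regular_base e -> regular_base (fun n => set_val @^-1` e n : set K).
Proof.
move=> [eo eb]; split=> [n|x U [_ [[W oW <-] Wx WU]]]; first by exists (e n).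
have [n [enx enW]] := eb (set_val x) W (open_nbhs_nbhs (conj oW Wx)).
exists n; split => // y cly; apply: WU; apply: enW => V Vy.
have [|z [ez Vz]] := cly (set_val @^-1` V); first exact: initial_continuous.
by exists (set_val z).
Qed.

Lemma is_metric_subtype {R : realType} {T : Type} (K : set T) (d : T -> T -> R) :
  is_metric d -> is_metric (fun x y : K => d (set_val x) (set_val y)).
Proof.
move=> [d0 deq dC dtri]; split => // x y; split=> [/deq|->]; first exact: val_inj.
exact/deq.
Qed.

Lemma metric_compatible_subtype {R : realType} {T : topologicalType} (K : set T)
    (d : T -> T -> R) : metric_compatible d ->
  metric_compatible (fun x y : K => d (set_val x) (set_val y)).
Proof.
move=> dc x U; split=> [[_ [[W oW <-] Wx WU]]|[r r0 rU]].
  have /dc[r r0 rW] := open_nbhs_nbhs (conj oW Wx).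
  by exists r => // y /= xy; apply: WU; exact: rW.
have dball : nbhs (set_val x) [set y | d (set_val x) y < r] by apply/dc; exists r.
by apply: (filterS rU); exact: initial_continuous dball.
Qed.

Lemma closure_ptws_eval {R : realType} {T : topologicalType} {P : countType}
    (B : set {ptws T -> {ptws P -> R}}) (f : {ptws T -> {ptws P -> R}}) (p : P) :
  closure B f -> eval_closure [set proj p \o g | g in B] (proj p \o f).
Proof.
move=> clf s U fU.
have [|g [Bg gU]] := clf [set g | forall x, x \in s -> U x (g x p)].
  have FF : Filter (nbhs f) by exact: nbhs_filter.
  have : forall x, x \in s -> nbhs f [set g | U x (g x p)].
    move=> x /fU fUx.
    apply: (@continuous_comp _ _ _ (fun g : {ptws T -> {ptws P -> R}} => g x)
      (fun h : {ptws P -> R} => h p) f _ _ _ fUx).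
      exact: (@proj_continuous T (fun=> {ptws P -> R})).
    exact: (@proj_continuous P (fun=> R)).
  elim: s {fU} => [|y s IH] sU; first by apply: filterE.
  have sx x : x \in s -> nbhs f [set g | U x (g x p)].
    by move=> xs; apply: sU; rewrite in_cons xs orbT.
  apply: filterS2 (sU y (mem_head _ _)) (IH sx) => g gy gs x.
  by rewrite in_cons => /orP[/eqP->|/gs].
by exists (proj p \o g) => //; exists g.
Qed.

Lemma baire1_coordinates {R : realType} {T : topologicalType} {P : countType}
    (f : {ptws T -> {ptws P -> R}}) :
  (forall p, exists2 u : nat -> T -> R, (forall n, continuous (u n)) &
    forall x, u n x @[n --> \oo] --> f x p) -> baire1 T {ptws P -> R} f.
Proof.
move=> fu; have /choice[u uP] p :
    exists u : nat -> T -> R, (forall n, continuous (u n)) /\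
    forall x, u n x @[n --> \oo] --> f x p.
  by have [u uc uf] := fu p; exists u.
exists (fun n x p => u p n x) => [n x|x]; apply: cvg_ptws => p.
  by have [+ _] := uP p; apply.
by have [_] := uP p; apply.
Qed.

(** Tychonoff is applied twice, over [P] and then over [T]. The resulting box is closed because the
    product is Hausdorff, so it contains the closure of [B]. *)
Lemma ptws_bounded_compact {R : realType} {T : choiceType} {P : countType}
    (B : set {ptws T -> {ptws P -> R}}) (M : T -> P -> R) :
  (forall f x p, B f -> `|f x p| <= M x p) -> compact (closure B).
Proof.
move=> BM.
pose I x : set {ptws P -> R} := [set g | forall p, `[- M x p, M x p]%classic (g p)].
pose Z := [set f : {ptws T -> {ptws P -> R}} | forall x, I x (f x)].
have cZ : compact Z.
  apply: (@tychonoff T (fun=> {ptws P -> R}) I) => x.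
  apply: (@tychonoff P (fun=> R) (fun p => `[- M x p, M x p]%classic)) => p.
  exact: segment_compact.
have hZ : closed Z.
  apply: compact_closed cZ.
  apply: (@hausdorff_product T (fun=> {ptws P -> R})) => x.
  by apply: (@hausdorff_product P (fun=> R)) => p; exact: norm_hausdorff.
apply: (subclosed_compact _ cZ); first exact: closed_closure.
rewrite closureE => f; apply; split => // g Bg x p.
by rewrite /= in_itv /= -ler_norml; exact: BM.
Qed.

(** * From relative compactness to NIP *)

Lemma nested_compact_nonempty {T : topologicalType} (Z : nat -> set T) :
  compact [set: T] -> (forall n, closed (Z n)) -> (forall n, Z n.+1 `<=` Z n) ->
  (forall n, Z n !=set0) -> exists y, forall n, Z n y.
Proof.
move=> cT Zcl Zdec /choice[y yZ].
have Zmono m n : (m <= n)%N -> Z n `<=` Z m.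
  elim: n => [|n IH]; first by rewrite leqn0 => /eqP->.
  by rewrite leq_eqVlt => /orP[/eqP->//|/IH mn] x /Zdec /mn.
have [y0 [_ y0cl]] := cT (y @ \oo) _ filterT.
exists y0 => n; apply: Zcl => U Uy0; apply: y0cl => //.
by exists n => // m /= nm; apply: (Zmono n m nm).
Qed.

(** Compactness yields a cluster point, not a convergent subsequence. Closed constraints on a single
    value that hold eventually along the sequence still pass to it. *)
Lemma relatively_compact_cluster {R : realType} {T : topologicalType}
    {P : countType} (S B : set {ptws T -> {ptws P -> R}})
    (F : nat -> {ptws T -> {ptws P -> R}}) :
  relatively_compact_in S B -> (forall n, B (F n)) ->
  exists2 q, S q & forall x p (C : set R), closed C ->
    (\forall n \near \oo, C (F n x p)) -> C (q x p).
Proof.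
move=> [BS cB] BF.
pose FS n : S := exist _ (F n) (mem_set (BS _ (BF n))).
have FB : (FS @ \oo) (closure (set_val @^-1` B)).
  by exists 0%N => // n _; apply: subset_closure; exact: BF.
have [q [_ qF]] := cB _ _ FB.
exists (set_val q) => [|x p C Ccl CF]; first exact: set_valP.
apply: Ccl => U qU.
have qV : nbhs q [set g : S | U (set_val g x p)].
  apply: (@initial_continuous S _ set_val q [set g | U (g x p)]).
  apply: (@continuous_comp _ _ _ (fun g : {ptws T -> {ptws P -> R}} => g x)
      (fun h : {ptws P -> R} => h p) (set_val q) _ _ _ qU).
    exact: (@proj_continuous T (fun=> {ptws P -> R})).
  exact: (@proj_continuous P (fun=> R)).
have [] := qF [set g : S | C (set_val g x p)] _ _ qV; first exact: CF.
by move=> g [Cg Ug]; exists (set_val g x p).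
Qed.

(* If NIP fails, a limit [h] of the independent sequence is below [a] or above
   [b] on branches that are eventually of one sign. A closed set [C j] of the
   cover coming from [h] being Baire 1 bounds [h] on one side, so it misses such a
   branch and, by compactness, already a finite part of it. Diagonalising over
   [j] gives a branch outside all [C j]. *)
Lemma relatively_compact_baire1_NIP {R : realType} {T : topologicalType}
    {P : countType} (B : set {ptws T -> {ptws P -> R}}) (p : P) :
  compact [set: T] -> (forall g, B g -> continuous (g : T -> {ptws P -> R})) ->
  relatively_compact_in (baire1 T {ptws P -> R}) B ->
  finitary_NIP [set proj p \o g | g in B].
Proof.
move=> cT Bc Brc f fB a b ab; apply: contrapT => noEF.
have /choice[G GP] n : exists G, B G /\ proj p \o G = f n.
  by have [G BG Gf] := fB n; exists G.
have fE n x : f n x = G n x p by case: (GP n) => _ <-.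
have fC n : continuous (f n).
  have [BG <-] := GP n => x; apply: continuous_comp; first exact: Bc.
  exact: (@proj_continuous P (fun=> R)).
have [q [U Uc Uq] qG] := relatively_compact_cluster _ _ G Brc (fun n => (GP n).1).
pose h k x := U k x p.
have hC k : continuous (h k).
  move=> x; apply: (@continuous_comp _ _ _ (U k) (fun g : {ptws P -> R} => g p)).
    exact: Uc.
  exact: (@proj_continuous P (fun=> R)).
have hq x : h k x @[k --> \oo] --> q x p.
  apply: (cvg_comp (U ^~ x) (fun g : {ptws P -> R} => g p) (Uq x)).
  exact: (@proj_continuous P (fun=> R)).
(* Since [c < c'], every value of the limit is above [c] or below [c'], which gives the cover. The
   gaps from [a] to [c] and from [c'] to [b] give the contradictions on branches. *)
have [c [c' [ac cc' c'b]]] : exists c c' : R, [/\ a < c, c < c' & c' < b].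
  by exists ((2 * a + b) / 3), ((a + 2 * b) / 3); split; lra.
have preim_ge (g : T -> R) (r : R) : continuous g -> closed [set x | r <= g x].
  by move=> gC; apply: (@closed_comp _ _ g [set y | r <= y]) => //; exact: closed_ge.
have preim_le (g : T -> R) (r : R) : continuous g -> closed [set x | g x <= r].
  by move=> gC; apply: (@closed_comp _ _ g [set y | y <= r]) => //; exact: closed_le.
(* The parity of [j] selects the side, so one sequence enumerates both families. Covering a point
   takes an index of the right parity beyond its threshold [N], namely [N.*2.+1] or [N.*2]. *)
pose C j := \bigcap_(k in [set k | (j <= k)%N])
  [set x | if odd j then c <= h k x else h k x <= c'].
have C_closed j : closed (C j).
  by apply: closed_bigI => k _; case: (odd j); [exact: preim_ge|exact: preim_le].
have C_cover x : exists j, C j x.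
  have [qc|qc] := ltP c (q x p).
    have /cvgr_ge /(_ _ qc) [N _ NP] := hq x.
    exists N.*2.+1 => k /= Nk; rewrite odd_double/=; apply: NP => /=.
    by apply: leq_trans Nk; rewrite -addnn; apply: leqW; exact: leq_addr.
  have /cvgr_le /(_ _ (le_lt_trans qc cc')) [N _ NP] := hq x.
  exists N.*2 => k /= Nk; rewrite odd_double/=; apply: NP => /=.
  by apply: leq_trans Nk; rewrite -addnn; exact: leq_addr.
pose L (s : seq bool) := \bigcap_(i in [set i | (i < size s)%N])
  [set x | if nth false s i then f i x <= a else b <= f i x].
have L_closed s : closed (L s).
  by apply: closed_bigI => k _; case: (nth _ _ _); [exact: preim_le|exact: preim_ge].
have L_neq0 s : L s !=set0.
  apply: contrapT => Ls0; apply: noEF.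
  exists [set i | (i < size s)%N /\ nth false s i],
    [set i | (i < size s)%N /\ ~~ nth false s i]; split.
  - by apply: (sub_finite_set _ (finite_II (size s))) => i [].
  - by apply: (sub_finite_set _ (finite_II (size s))) => i [].
  - by apply/seteqP; split=> // i [[_ +] [_]] => ->.
  - apply/seteqP; split=> // x [xE xF]; apply: Ls0; exists x => i /= si.
    by case: ifPn => ns; [apply: xE|apply: xF].
have L_cat s t : L (s ++ t) `<=` L s.
  move=> x Lx i /= si; have := Lx i; rewrite /= size_cat nth_cat si; apply.
  exact: ltn_addr.
(* The sign [odd j] opposes [C j]: for odd [j] it forces the limit below [a] while [C j] keeps it
   above [c], and for even [j] above [b] against [c']. *)
have miss (sj : seq bool * nat) :
    exists m, L (sj.1 ++ nseq m (odd sj.2)) `&` C sj.2 = set0.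
  case: sj => s j /=; apply: contrapT => nm.
  have [|||x xL] := nested_compact_nonempty
      (fun m => L (s ++ nseq m (odd j)) `&` C j) cT.
  - by move=> m; apply: closedI.
  - move=> m x [Lx Cx]; split => //.
    by apply: (L_cat _ (nseq 1 (odd j))); rewrite -catA -nseqD addn1; exact: Lx.
  - by move=> m; apply/set0P/eqP => m0; apply: nm; exists m.
  have Lx n : (size s <= n)%N -> if odd j then f n x <= a else b <= f n x.
    move=> sn.
    have snt : (n < size (s ++ nseq (n - size s).+1 (odd j)))%N.
      by rewrite size_cat size_nseq addnS subnKC.
    have [/(_ n snt) + _] := xL (n - size s).+1.
    by rewrite /mkset (_ : nth _ _ _ = odd j)// nth_cat ifN -?leqNgt// nth_nseq ltnSn.
  have Cx k : (j <= k)%N -> if odd j then c <= h k x else h k x <= c'.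
    by have [_] := xL 0%N; apply.
  case: (odd j) Lx Cx => Lx Cx.
  - have : q x p <= a.
      apply: (qG x p [set r | r <= a]); first exact: closed_le.
      by exists (size s) => // n /= sn; rewrite -fE; exact: Lx.
    have : c <= q x p.
      by apply: (cvgr_to_ge (hq x)); exists j => // k jk; exact: Cx.
    lra.
  - have : b <= q x p.
      apply: (qG x p [set r | b <= r]); first exact: closed_ge.
      by exists (size s) => // n /= sn; rewrite -fE; exact: Lx.
    have : q x p <= c'.
      by apply: (cvgr_to_le (hq x)); exists j => // k jk; exact: Cx.
    lra.
have [m mP] := choice miss.
pose s := fix s j := if j is j'.+1 then s j' ++ nseq (m (s j', j')) (odd j') else [::].
have [|||y yL] := nested_compact_nonempty (L \o s) cT.
- by move=> j; exact: L_closed.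
- by move=> j; exact: L_cat.
- by move=> j; exact: L_neq0.
have [j Cy] := C_cover y.
suff : set0 y by [].
by rewrite -(mP (s j, j)); split => //; exact: (yL j.+1).
Qed.

(** * The equivalence over a compact subset of a Polish space *)

Theorem theorem1p11 (R : realType) (P : countType) (X : topologicalType)
    (polishX : polish R X)
    (A : set (X -> {ptws P -> R}))
    (Acont : A `<=` [set f | continuous f])
    (Abounded : forall p : P, pointwise_bounded_set [set proj p \o f | f in A])
    (K : set X) (Kcompact : compact K) :
  relatively_compact_in (baire1 K {ptws P -> R}) [set sigL K f | f in A] <->
  (forall p : P, finitary_NIP [set proj p \o g | g in [set sigL K f | f in A]]).
Proof.
have [sepX [d [dm dc _]]] := polishX.
set B : set {ptws K -> {ptws P -> R}} := [set sigL K f | f in A].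
have Bc : forall g, B g -> continuous (g : K -> {ptws P -> R}).
  move=> _ [f Af <-] x; apply: continuous_comp; first exact: initial_continuous.
  exact: Acont.
split=> [Brc p|NIP].
  exact: relatively_compact_baire1_NIP (compact_subtypeT K Kcompact) Bc Brc.
have [e eb] := separable_metric_regular_base d dm dc sepX.
have Bb : B `<=` baire1 K {ptws P -> R}.
  by move=> g Bg; exists (fun=> g) => [_|x]; [exact: Bc|exact: cvg_cst].
have /choice[M MP] (x : K) :
    exists M : P -> R, forall p f, A f -> `|f (set_val x) p| <= M p.
  have /choice[M MP] p : exists M, forall f, A f -> `|f (set_val x) p| <= M.
    have [M [_ MP]] := Abounded p (set_val x).
    (* [bounded_set] guarantees the bound only for reals strictly above its threshold, hence
       [M + 1]. *)
    exists (M + 1) => f Af; apply: (MP (M + 1)); first by rewrite ltrDl.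
    by exists (proj p \o f) => //; exists f.
  by exists M => p f; exact: MP.
apply: relatively_compact_inP Bb.
  by apply: (ptws_bounded_compact _ M) => _ x p [f Af <-]; exact: MP.
move=> f clf; apply: baire1_coordinates => p.
have pBc : [set proj p \o g | g in B] `<=` [set g : K -> R | continuous g].
  move=> _ [g Bg <-] x; apply: continuous_comp; first exact: Bc.
  exact: (@proj_continuous P (fun=> R)).
exact: (NIP_closure_baire1 _ _ _ (proj p \o f) (is_metric_subtype K d dm)
  (metric_compatible_subtype K d dc) (regular_base_subtype K e eb) pBc (NIP p)
  (closure_ptws_eval B f p clf)).
Qed.
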